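(* Let $\lambda<0$ and let $F_\lambda$ be the cumulative distribution function with density $f_\lambda(x)=2\phi(x)\Phi(\lambda x)$, $x\in\mathbb{R}$. For each positive integer $n$, let $b_n>0$ be the solution of the equation $\pi|\lambda|(1+\lambda^2)b_n^2\exp\left(\tfrac{(1+\lambda^2)b_n^2}{2}\right)=n$ and let $a_n=(1+\lambda^2)^{-1}b_n^{-1}$. Then there exist a positive integer $n_0(\lambda)$, depending only on $\lambda$, and positive constants $C'_\lambda$ and $C''_\lambda$, independent of $n$, such that for all integers $n\ge n_0(\lambda)$, $$\frac{C'_\lambda}{\log n}<\sup_{x\in\mathbb{R}}\left|F_\lambda^n(a_nx+b_n)-\Lambda(x)\right|<\frac{C''_\lambda}{\log n},$$ where $\Lambda(x)=\exp(-\exp(-x))$ and $F_\lambda^n(y)=(F_\lambda(y))^n$.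
   Context: $\phi$ and $\Phi$ denote, respectively, the probability density function and the cumulative distribution function of the standard normal distribution. $F_\lambda$ is the cumulative distribution function of the standard skew-normal distribution with parameter $\lambda$, i.e. $F_\lambda(y)=\int_{-\infty}^y 2\phi(t)\Phi(\lambda t)\,dt$. $\Lambda(x)=\exp(-\exp(-x))$ is the Gumbel extreme value distribution function. *)

(* Defs.v *)
From HB Require Import structures.
From mathcomp Require Import all_boot all_order all_algebra.
From mathcomp Require Import all_classical all_reals all_analysis.

Set Implicit Arguments.
Unset Strict Implicit.
Unset Printing Implicit Defensive.

Import Order.TTheory GRing.Theory Num.Theory.
Import numFieldNormedType.Exports.

Local Open Scope classical_set_scope.
Local Open Scope ring_scope.

Definition std_normal_pdf {R : realType} (x : R) : R := normal_pdf 0 1 x.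

Definition std_normal_cdf {R : realType} (x : R) : R :=
  fine (normal_prob (0 : R) 1 `]-oo, x]).

Definition skew_normal_pdf {R : realType} (lambda x : R) : R :=
  2 * std_normal_pdf x * std_normal_cdf (lambda * x).

Definition skew_normal_cdf {R : realType} (lambda y : R) : R :=
  \int[lebesgue_measure]_(t in `]-oo, y]) skew_normal_pdf lambda t.

Definition gumbel_cdf {R : realType} (x : R) : R := expR (- expR (- x)).

(* Main.v *)
Require Import Defs.
From HB Require Import structures.
From mathcomp Require Import all_boot all_order all_algebra.
From mathcomp Require Import all_classical all_reals all_analysis.
From mathcomp Require Import measurable_realfun ring lra zify.

Set Implicit Arguments.
Unset Strict Implicit.
Unset Printing Implicit Defensive.

Import Order.TTheory GRing.Theory Num.Theory.
Import numFieldNormedType.Exports.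

Local Open Scope classical_set_scope.
Local Open Scope ring_scope.

(** Write [k = 1 + lambda^2] and [m = - lambda]. Differentiating, Mills' bounds
    for the normal tail give, for [y] large,
      [1 - F y = exp (- k y^2 / 2) / (pi m k y^2) * (1 - theta / y^2)]
    with [1 / k <= theta <= 2 / k + 1 / m^2]. With [y = a_n x + b_n] this makes
    [u = n (1 - F y)] equal to [e^(-x) (1 + O ((1 + x^2) / b_n^2))] as long as
    [x >= - b_n], and then [F^n] is [e^(-u)] up to [O (1 / n)], so it differs from
    [exp (- e^(-x))] by [O (1 / b_n^2)]. For [x <= - b_n] both functions are
    nondecreasing and already [O (1 / b_n^2)] at [- b_n]. At [x = 0],
    [u <= 1 - 1 / (k b_n^2)] gives a lower bound of the same order. Finally
    [log n] is comparable to [b_n^2]. *)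

(** * Inequalities from the sign of a derivative *)

Lemma le_of_derive_ge0 (R : realType) (f df : R -> R) (x y : R) : x <= y ->
  (forall z, x <= z -> is_derive z 1 f (df z)) ->
  (forall z, x <= z -> 0 <= df z) -> f x <= f y.
Proof.
move=> xy fE df0; have fc : {within `[x, y], continuous f}.
  apply: derivable_within_continuous => z; rewrite in_itv/= => /andP[xz _].
  by have [] := fE z xz.
have [|c] := @MVT_segment R f df x y xy _ fc.
  by move=> z; rewrite in_itv/= => /andP[/ltW xz _]; exact: fE.
rewrite in_itv/= => /andP[xc _] fyx.
by rewrite -subr_ge0 fyx mulr_ge0 ?df0 ?subr_ge0.
Qed.

(** A nonincreasing function stays above its limit. This turns a comparison of derivatives into a
    bound on a tail, with no integration. *)
Lemma ge0_of_derive_le0_cvg0 (R : realType) (f df : R -> R) (x : R) :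
  (forall z, x <= z -> is_derive z 1 f (df z)) ->
  (forall z, x <= z -> df z <= 0) -> f z @[z --> +oo] --> 0 -> 0 <= f x.
Proof.
move=> fE df0 f0; apply: (cvgr_to_le f0).
near=> y; have xy : x <= y by near: y; apply: nbhs_pinfty_ge; exact: num_real.
rewrite -lerN2; apply: (@le_of_derive_ge0 R (- f) (fun z => - df z)) => // z xz.
  by apply: is_deriveN; exact: fE.
by rewrite oppr_ge0 df0.
Unshelve. all: by end_near. Qed.

(** * The standard normal law and Mills' bounds for its tail *)

Section standard_normal.
Variable R : realType.
Implicit Types x y z : R.
Local Notation phi := (@std_normal_pdf R).
Local Notation Phi := (@std_normal_cdf R).
Local Notation mu := (@lebesgue_measure R).

Lemma std_normal_pdfE x :
  phi x = (Num.sqrt (2 * pi))^-1 * expR (- (x ^+ 2 / 2)).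
Proof.
rewrite /std_normal_pdf normal_pdfE ?oner_neq0//= /normal_peak /normal_fun.
by rewrite subr0 expr1n mul1r -mulr_natl mulNr.
Qed.

Lemma std_normal_pdf_gt0 x : 0 < phi x.
Proof.
rewrite std_normal_pdfE mulr_gt0 ?expR_gt0// invr_gt0 sqrtr_gt0.
by rewrite mulr_gt0 ?pi_gt0.
Qed.

Lemma std_normal_pdfN x : phi (- x) = phi x.
Proof. by rewrite !std_normal_pdfE sqrrN. Qed.

(** With [y = - lambda * x] the two Gaussian factors merge into one, of exponent
    [- k * x ^+ 2 / 2]. *)
Lemma std_normal_pdfM x y :
  2 * phi x * phi y = pi^-1 * expR (- ((x ^+ 2 + y ^+ 2) / 2)).
Proof.
rewrite !std_normal_pdfE.
have -> : 2 * ((Num.sqrt (2 * pi))^-1 * expR (- (x ^+ 2 / 2))) *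
  ((Num.sqrt (2 * pi))^-1 * expR (- (y ^+ 2 / 2))) =
  2 * ((Num.sqrt (2 * pi)) ^+ 2)^-1 *
  (expR (- (x ^+ 2 / 2)) * expR (- (y ^+ 2 / 2))) :> R.
  by rewrite -exprVn; ring.
rewrite sqr_sqrtr ?mulr_ge0 ?pi_ge0// invfM (mulrA 2) divff ?pnatr_eq0// mul1r.
by rewrite -expRD; congr (_ * expR _); ring.
Qed.

Lemma is_derive_std_normal_pdf x : is_derive x 1 phi (- x * phi x).
Proof.
have -> : phi = (Num.sqrt (2 * pi))^-1 \*: (expR \o (fun z => - (z ^+ 2 / 2))).
  by apply/funext => z; rewrite std_normal_pdfE.
apply: is_derive_eq; rewrite /= /GRing.scale/=.
by set c := (Num.sqrt _)^-1; field.
Qed.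

Lemma continuous_std_normal_pdf : continuous phi.
Proof. by apply: continuous_normal_pdf; rewrite oner_neq0. Qed.

Lemma integrable_std_normal_pdf (A : set R) : measurable A ->
  mu.-integrable A (EFin \o phi).
Proof.
move=> mA; apply: integrableS (@integrable_normal_pdf R 0 1) => //.
Qed.

Lemma std_normal_cdfE x : Phi x = \int[mu]_(t in `]-oo, x]) phi t.
Proof. by []. Qed.

Lemma is_derive_std_normal_cdf x : is_derive x 1 Phi (phi x).
Proof.
have [] := @continuous_FTC1 R phi -oo%O x (x + 1).
- by rewrite ltrDl.
- exact: integrable_std_normal_pdf.
- by rewrite ltNyr.
- exact: continuous_std_normal_pdf.
move=> dPhi PhiE; rewrite -PhiE derive1E; exact: derivableP.
Qed.

Lemma std_normal_cdf_ge0 x : 0 <= Phi x.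
Proof. by rewrite fine_ge0// measure_ge0. Qed.

Lemma std_normal_cdf_le1 x : Phi x <= 1.
Proof.
rewrite -lee_fin fineK ?fin_num_measure//; exact: probability_le1.
Qed.

(** The identity as a random variable makes [Phi] the distribution function of a law, whose limits
    at infinity are known. *)
Let id_rv : measurableTypeR R -> R := idfun.

#[local] HB.instance Definition _ :=
  @isMeasurableFun.Build _ _ _ _ id_rv (@measurable_id _ _ setT).

Let std_normal_cdf_cdf :
  Phi = fine \o cdf (id_rv : {RV (@normal_prob R 0 1) >-> R}).
Proof. by []. Qed.

Lemma cvgy_std_normal_cdf : Phi x @[x --> +oo] --> (1 : R).
Proof. by rewrite std_normal_cdf_cdf; apply: fine_cvg; exact: cvg_cdfy1. Qed.

Lemma cvgNy_std_normal_cdf : Phi x @[x --> -oo] --> (0 : R).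
Proof. by rewrite std_normal_cdf_cdf; apply: fine_cvg; exact: cvg_cdfNy0. Qed.

Lemma cvgy_std_normal_cdfN : Phi (- x) @[x --> +oo] --> (0 : R).
Proof. by apply/(@cvgNy_compNP _ _ Phi); exact: cvgNy_std_normal_cdf. Qed.

Lemma is_derive_std_normal_cdfN x :
  is_derive x 1 (fun z => Phi (- z)) (- phi x).
Proof.
apply: is_derive_eq.
  by apply: (@is_derive1_comp R Phi -%R); exact: is_derive_std_normal_cdf.
by rewrite std_normal_pdfN mulrN1.
Qed.

(** [phi] is even, so the sum has derivative 0; its constant value is read off at infinity. *)
Lemma std_normal_cdfN x : Phi x + Phi (- x) = 1.
Proof.
pose f := fun z => Phi z + Phi (- z).
have f1 : f z @[z --> +oo] --> (1 + 0 : R).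
  by apply: cvgD; [exact: cvgy_std_normal_cdf|exact: cvgy_std_normal_cdfN].
have fE y : f y = f x.
  apply: is_derive_0_is_cst => z.
  apply: is_derive_eq; last exact: (subrr (phi z)).
  apply: is_deriveD; last exact: is_derive_std_normal_cdfN.
  exact: is_derive_std_normal_cdf.
have fcst : f = cst (f x) by apply/funext => y; exact: fE.
rewrite addr0 fcst in f1.
by apply: (cvg_unique _ _ f1) => //; exact: cvg_cst.
Qed.

Lemma is_derive_invr z : 0 < z ->
  is_derive z 1 (fun y : R => y^-1) (- z^-1 ^+ 2).
Proof.
move=> z0; apply: is_derive_eq.
  by apply: (@is_deriveV R id); rewrite gt_eqF.
by rewrite /GRing.scale/= mulr1 exprVn.
Qed.

Lemma cvgy0_of_le_inv (f : R -> R) (C : R) :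
  (forall z, 1 <= z -> `|f z| <= C / z) -> f z @[z --> +oo] --> (0 : R).
Proof.
move=> fC; apply/cvgr0Pnorm_le => e e0; near=> z.
have z1 : 1 <= z by near: z; apply: nbhs_pinfty_ge; exact: num_real.
rewrite (le_trans (fC z z1))// ler_pdivrMr ?(lt_le_trans _ z1)// mulrC.
by rewrite -ler_pdivrMr//; near: z; apply: nbhs_pinfty_ge; exact: num_real.
Unshelve. all: by end_near. Qed.

Lemma std_normal_pdf_le1 x : phi x <= 1.
Proof.
rewrite std_normal_pdfE -[leRHS]mul1r ler_pM ?invr_ge0 ?expR_ge0 ?sqrtr_ge0//.
  rewrite invf_le1 ?sqrtr_gt0 ?mulr_gt0 ?pi_gt0// -[leLHS]sqrtr1 ler_sqrt.
    by have := pi_ge2 R; lra.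
  by rewrite mulr_ge0 ?pi_ge0.
by rewrite expR_le1 oppr_le0 divr_ge0 ?sqr_ge0.
Qed.

(** Right side minus left side tends to 0 at infinity and has derivative [- phi y / y ^+ 2]. The
    lower bound is obtained in the same way. *)
Lemma std_normal_tail_le z : 0 < z -> Phi (- z) <= phi z * z^-1.
Proof.
move=> z0; rewrite -subr_ge0.
apply: (@ge0_of_derive_le0_cvg0 R (fun y => phi y * y^-1 - Phi (- y))
  (fun y => - (phi y * y^-1 ^+ 2))) => [y zy|y zy|].
- have y0 := lt_le_trans z0 zy.
  have h1 := is_derive_invr y0; have h2 := is_derive_std_normal_cdfN y.
  have h3 := is_derive_std_normal_pdf y.
  apply: is_derive_eq; rewrite /GRing.scale/=; field.
  by rewrite gt_eqF.
- by rewrite oppr_le0 mulr_ge0 ?sqr_ge0// ltW// std_normal_pdf_gt0.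
- rewrite -(subr0 0); apply: cvgB; last exact: cvgy_std_normal_cdfN.
  apply: (@cvgy0_of_le_inv _ 1) => y y1.
  have y0 : 0 < y by lra.
  rewrite ger0_norm ?mulr_ge0 ?invr_ge0 ?(ltW (std_normal_pdf_gt0 _)) ?(ltW y0)//.
  by rewrite ler_pM2r ?invr_gt0 ?std_normal_pdf_le1.
Qed.

Lemma std_normal_tail_ge z : 0 < z ->
  phi z * (z^-1 - z^-1 ^+ 3) <= Phi (- z).
Proof.
move=> z0; rewrite -subr_ge0.
apply: (@ge0_of_derive_le0_cvg0 R
  (fun y => Phi (- y) - phi y * (y^-1 - y^-1 ^+ 3))
  (fun y => - (3 * phi y * y^-1 ^+ 4))) => [y zy|y zy|].
- have y0 := lt_le_trans z0 zy.
  have h1 := is_derive_invr y0; have h2 := is_derive_std_normal_cdfN y.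
  have h3 := is_derive_std_normal_pdf y.
  apply: is_derive_eq; rewrite /GRing.scale/=; field.
  by rewrite gt_eqF.
- rewrite oppr_le0; apply: mulr_ge0; last exact: exprn_even_ge0.
  by rewrite mulr_ge0// ltW// std_normal_pdf_gt0.
- rewrite -(subr0 0); apply: cvgB; first exact: cvgy_std_normal_cdfN.
  apply: (@cvgy0_of_le_inv _ 1) => y y1.
  have y0 : 0 < y^-1 by rewrite invr_gt0; lra.
  have y1' : y^-1 <= 1 by rewrite invf_le1//; lra.
  have w3 : 0 <= y^-1 - y^-1 ^+ 3.
    have -> : y^-1 - y^-1 ^+ 3 = y^-1 * (1 - y^-1) * (1 + y^-1) by ring.
    by rewrite !mulr_ge0//; lra.
  have w30 : 0 <= y^-1 ^+ 3 by rewrite exprn_ge0// ltW.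
  rewrite ger0_norm ?mulr_ge0 ?(ltW (std_normal_pdf_gt0 _))// mul1r.
  by rewrite (le_trans (ler_piMl w3 (std_normal_pdf_le1 _)))//; lra.
Qed.

End standard_normal.

(** * The skew-normal distribution function *)

Section skew_normal.
Variables (R : realType) (lambda : R).
Implicit Types x y z : R.
Local Notation phi := (@std_normal_pdf R).
Local Notation Phi := (@std_normal_cdf R).
Local Notation mu := (@lebesgue_measure R).
Local Notation f := (@skew_normal_pdf R lambda).
Local Notation F := (@skew_normal_cdf R lambda).

Lemma skew_normal_pdf_ge0 x : 0 <= f x.
Proof.
by rewrite !mulr_ge0 ?std_normal_cdf_ge0// ltW// std_normal_pdf_gt0.
Qed.

Lemma skew_normal_pdf_le x : f x <= 2 * phi x.
Proof.
rewrite ler_piMr ?std_normal_cdf_le1// mulr_ge0// ltW//.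
exact: std_normal_pdf_gt0.
Qed.

Lemma skew_normal_pdfN x : f x + f (- x) = 2 * phi x.
Proof.
rewrite /skew_normal_pdf std_normal_pdfN mulrN -mulrDr.
by rewrite std_normal_cdfN mulr1.
Qed.

Lemma continuous_skew_normal_pdf : continuous f.
Proof.
move=> x; apply: cvgM.
  by apply: cvgM; [exact: cvg_cst|exact: continuous_std_normal_pdf].
apply: (@continuous_comp _ _ _ (fun y => lambda * y) Phi).
  exact: mulrl_continuous.
apply/differentiable_continuous/derivable1_diffP.
by have [] := is_derive_std_normal_cdf (lambda * x).
Qed.

Lemma integrable_skew_normal_pdf (A : set R) : measurable A ->
  mu.-integrable A (EFin \o f).
Proof.
move=> mA; apply: (@le_integrable _ _ R mu A mA (EFin \o f)
  (fun x => (2%:E * (phi x)%:E)%E)).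
- apply/measurable_EFinP; apply: measurable_funTS.
  exact: continuous_measurable_fun continuous_skew_normal_pdf.
- move=> x _; rewrite -EFinM !abse_EFin lee_fin.
  rewrite (ger0_norm (skew_normal_pdf_ge0 _)).
  by rewrite (le_trans (skew_normal_pdf_le x))// ler_norm.
- by apply: integrableZl => //; exact: integrable_std_normal_pdf.
Qed.

Lemma is_derive_skew_normal_cdf x : is_derive x 1 F (f x).
Proof.
have [] := @continuous_FTC1 R f -oo%O x (x + 1).
- by rewrite ltrDl.
- exact: integrable_skew_normal_pdf.
- by rewrite ltNyr.
- exact: continuous_skew_normal_pdf.
move=> dF FE; rewrite -FE derive1E; exact: derivableP.
Qed.

Lemma skew_normal_cdf_ge0 x : 0 <= F x.
Proof. by apply: Rintegral_ge0 => y _; exact: skew_normal_pdf_ge0. Qed.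

Lemma skew_normal_cdf_le x : F x <= 2 * Phi x.
Proof.
rewrite std_normal_cdfE -RintegralZl//; last exact: integrable_std_normal_pdf.
apply: le_Rintegral => //.
- exact: integrable_skew_normal_pdf.
- have -> : EFin \o (fun y => 2 * phi y) = (fun y => 2%:E * (phi y)%:E)%E.
    by apply/funext => y; rewrite /= EFinM.
  by apply: integrableZl => //; exact: integrable_std_normal_pdf.
- by move=> y _; exact: skew_normal_pdf_le.
Qed.

Lemma skew_normal_cdf_homo x y : x <= y -> F x <= F y.
Proof.
move=> xy; apply: (le_of_derive_ge0 xy) => z _.
  exact: is_derive_skew_normal_cdf.
exact: skew_normal_pdf_ge0.
Qed.

Lemma cvgy_skew_normal_cdfN : F (- x) @[x --> +oo] --> (0 : R).
Proof.
apply: (@squeeze_cvgr _ _ _ _ (cst 0) (fun x => 2 * Phi (- x))).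
- by near=> x; rewrite skew_normal_cdf_ge0 skew_normal_cdf_le.
- exact: cvg_cst.
- rewrite -(mulr0 2); apply: cvgM; first exact: cvg_cst.
  exact: cvgy_std_normal_cdfN.
Unshelve. all: by end_near. Qed.

(* Yields the total mass of [f] without any change of variables: both sides
   have derivative [2 phi]. *)
Lemma skew_normal_cdf_reflection x : F x - F (- x) = 2 * Phi x - 1.
Proof.
pose g z := F z - F (- z) - 2 * Phi z.
have g0 : g x = g 0.
  apply: is_derive_0_is_cst => z.
  have h1 := is_derive_skew_normal_cdf z.
  have h2 : is_derive z 1 (fun y => F (- y)) (- f (- z)).
    apply: is_derive_eq.
      by apply: (@is_derive1_comp R F -%R); exact: is_derive_skew_normal_cdf.
    by rewrite mulrN1.
  have h3 := is_derive_std_normal_cdf z.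
  apply: is_derive_eq; rewrite /GRing.scale/=.
  by have := skew_normal_pdfN z; lra.
(* At 0 the constant is [- 2 * Phi 0], that is, [-1]. *)
have := std_normal_cdfN (0 : R).
by move: g0; rewrite /g oppr0; lra.
Qed.

Lemma cvgy_skew_normal_cdf : F x @[x --> +oo] --> (1 : R).
Proof.
have -> : F = (fun x => F (- x) + (2 * Phi x - cst 1 x)).
  by apply/funext => x; rewrite /= -skew_normal_cdf_reflection; ring.
rewrite [X in _ --> X](_ : _ = 0 + (2 * 1 - 1) :> R); last by ring.
apply: cvgD; first exact: cvgy_skew_normal_cdfN.
apply: cvgB; last exact: cvg_cst.
by apply: cvgM; [exact: cvg_cst|exact: cvgy_std_normal_cdf].
Qed.

Lemma skew_normal_cdf_le1 x : F x <= 1.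
Proof.
rewrite -lerN2; apply: (cvgr_to_le (cvgN cvgy_skew_normal_cdf)).
near=> y; rewrite lerN2; apply: skew_normal_cdf_homo.
by near: y; apply: nbhs_pinfty_ge; exact: num_real.
Unshelve. all: by end_near. Qed.

End skew_normal.

(** * Two-sided bounds for the skew-normal tail *)

Section skew_normal_tail.
Variables (R : realType) (lambda : R).
Hypothesis lambda_lt0 : lambda < 0.
Implicit Types x y z c : R.
Local Notation phi := (@std_normal_pdf R).
Local Notation Phi := (@std_normal_cdf R).
Local Notation f := (@skew_normal_pdf R lambda).
Local Notation F := (@skew_normal_cdf R lambda).
Local Notation k := (1 + lambda ^+ 2).

Let k_gt0 : 0 < k. Proof. by have := sqr_ge0 lambda; lra. Qed.
Let E y := expR (- (k * y ^+ 2 / 2)).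
Let E_gt0 y : 0 < E y. Proof. exact: expR_gt0. Qed.

(** Mills' bounds at [- lambda * y], positive because [lambda < 0]; the product
    [2 phi(y) phi(- lambda y)] is [E y / pi]. *)
Lemma skew_normal_pdf_mills y : 0 < y ->
  E y * (y^-1 - y^-1 ^+ 3 / lambda ^+ 2) <= pi * (- lambda) * f y
  <= E y * y^-1.
Proof.
move=> y0; have my0 : 0 < - lambda * y by rewrite mulr_gt0 ?oppr_gt0.
have pE : pi * (2 * phi y * phi (- lambda * y)) = E y.
  rewrite std_normal_pdfM mulrA divff ?gt_eqF ?pi_gt0// mul1r.
  by congr expR; ring.
have cst : 0 <= 2 * phi y by rewrite mulr_ge0// ltW// std_normal_pdf_gt0.
have l0 : 0 < pi * - lambda by rewrite mulr_gt0 ?pi_gt0 ?oppr_gt0.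
have l1 : lambda != 0 by rewrite lt_eqF.
have y1 : y != 0 by rewrite gt_eqF.
have -> : f y = 2 * phi y * Phi (- (- lambda * y)) by rewrite mulNr opprK.
apply/andP; split.
  have -> : E y * (y^-1 - y^-1 ^+ 3 / lambda ^+ 2) = pi * - lambda * (2 * phi y *
      (phi (- lambda * y) * ((- lambda * y)^-1 - (- lambda * y)^-1 ^+ 3))).
    by rewrite -pE; field; rewrite l1 y1.
  by rewrite ler_wpM2l ?(ltW l0)// ler_wpM2l//; exact: std_normal_tail_ge.
have -> : E y * y^-1 = pi * - lambda * (2 * phi y *
    (phi (- lambda * y) * (- lambda * y)^-1)).
  by rewrite -pE; field; rewrite l1 y1.
by rewrite ler_wpM2l ?(ltW l0)// ler_wpM2l//; exact: std_normal_tail_le.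
Qed.

(** Leading term and first correction from integrating [k * E y / y] by parts; [c] is tuned so that
    [W c] minus the scaled tail is monotone. *)
Let W c y := E y * (y^-1 ^+ 2 - c * y^-1 ^+ 4).

Let is_derive_W c y : 0 < y -> is_derive y 1 (W c)
  (- (E y * (k * y^-1 - (c * k - 2) * y^-1 ^+ 3 - 4 * c * y^-1 ^+ 5))).
Proof.
move=> y0; have h1 := is_derive_invr y0.
have h2 : is_derive y 1 E (- (k * y) * E y).
  by rewrite /E; apply: is_derive_eq; rewrite /GRing.scale/=; field.
apply: is_derive_eq; rewrite /GRing.scale/=; field.
by rewrite gt_eqF.
Qed.

Let cvgy_W c : W c y @[y --> +oo] --> (0 : R).
Proof.
apply: (@cvgy0_of_le_inv _ _ (1 + `|c|)) => y y1; rewrite /W normrM.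
have y0 : 0 < y^-1 by rewrite invr_gt0; lra.
have y1' : y^-1 <= 1 by rewrite invf_le1//; lra.
rewrite (ger0_norm (ltW (E_gt0 _))) -[leRHS]mul1r.
apply: ler_pM; rewrite ?normr_ge0 ?(ltW (E_gt0 _))//.
  by rewrite expR_le1 oppr_le0 divr_ge0// mulr_ge0 ?sqr_ge0// ltW.
rewrite (le_trans (ler_normB _ _))// mulrDl mul1r (normrM c).
rewrite !(ger0_norm (exprn_ge0 _ (ltW y0))) lerD ?ler_wpM2l//.
  by rewrite -[leRHS]expr1 ler_wiXn2l ?(ltW y0).
by rewrite -[leRHS]expr1 ler_wiXn2l ?(ltW y0).
Qed.

Let is_derive_tail y :
  is_derive y 1 (fun x => pi * - lambda * k * (1 - F x))
    (- (pi * - lambda * k * f y)).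
Proof.
have h := is_derive_skew_normal_cdf lambda y.
by apply: is_derive_eq; rewrite /GRing.scale/=; ring.
Qed.

Let cvgy_tail : pi * - lambda * k * (1 - F y) @[y --> +oo] --> (0 : R).
Proof.
rewrite [X in _ --> X](_ : _ = pi * - lambda * k * (1 - 1) :> R); last by ring.
apply: cvgM; first exact: cvg_cst.
by apply: cvgB; [exact: cvg_cst|exact: cvgy_skew_normal_cdf].
Qed.

(** For [c = 1 / k] the coefficient [c * k - 2] is [-1], and [4 <= k * y ^+ 2] lets the cubic term
    absorb the one of order 5. So [- W'] dominates [k * E z / z], hence the scaled density by Mills'
    upper bound. *)
Lemma skew_normal_tail_le y : 0 < y -> 4 <= k * y ^+ 2 ->
  pi * - lambda * k * (1 - F y)
  <= expR (- (k * y ^+ 2 / 2)) * (y^-1 ^+ 2 - k^-1 * y^-1 ^+ 4).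
Proof.
move=> y0 ky; rewrite -subr_ge0 -/(E y) -/(W k^-1 y).
apply: (@ge0_of_derive_le0_cvg0 R
  (fun z => W k^-1 z - pi * - lambda * k * (1 - F z))
  (fun z => - (E z * (k * z^-1 - (k^-1 * k - 2) * z^-1 ^+ 3
     - 4 * k^-1 * z^-1 ^+ 5)) - - (pi * - lambda * k * f z))) => [z yz|z yz|].
- by have := is_derive_W k^-1 (lt_le_trans y0 yz) => h; exact: is_deriveB.
- have z0 := lt_le_trans y0 yz.
  have kz : 4 <= k * z ^+ 2.
    by rewrite (le_trans ky)// ler_pM2l// ler_sqr ?nnegrE// ltW.
  have /andP[_ fz] := skew_normal_pdf_mills z0.
  have w5 : 4 * k^-1 * z^-1 ^+ 5 <= z^-1 ^+ 3.
    have -> : z^-1 ^+ 3 = (k * z ^+ 2) * (k^-1 * z^-1 ^+ 5).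
      by field; rewrite !gt_eqF.
    by rewrite -mulrA ler_wpM2r// mulr_ge0 ?exprn_ge0 ?invr_ge0 ?ltW.
  have kk : k * (pi * - lambda * f z) <= k * (E z * z^-1) by rewrite ler_pM2l.
  have Ez : E z * (4 * k^-1 * z^-1 ^+ 5) <= E z * z^-1 ^+ 3.
    by rewrite ler_pM2l.
  rewrite mulVf ?gt_eqF//.
  set w := z^-1 in kk Ez *; set e := E z in kk Ez *.
  by rewrite opprK; nra.
- by rewrite -(subr0 0); apply: cvgB; [exact: cvgy_W|exact: cvgy_tail].
Qed.

(** [K] is chosen so that [K * k - 2 = k / lambda ^+ 2]: the cubic term of [- W'] is then that of
    Mills' lower bound, and the term of order 5 has the favourable sign for every [y > 0]. *)
Lemma skew_normal_tail_ge y : 0 < y ->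
  expR (- (k * y ^+ 2 / 2)) *
    (y^-1 ^+ 2 - (2 / k + 1 / lambda ^+ 2) * y^-1 ^+ 4)
  <= pi * - lambda * k * (1 - F y).
Proof.
move=> y0; set K := 2 / k + _; rewrite -subr_ge0 -/(E y) -/(W K y).
apply: (@ge0_of_derive_le0_cvg0 R
  (fun z => pi * - lambda * k * (1 - F z) - W K z)
  (fun z => - (pi * - lambda * k * f z) - - (E z * (k * z^-1
     - (K * k - 2) * z^-1 ^+ 3 - 4 * K * z^-1 ^+ 5)))) => [z yz|z yz|].
- by have := is_derive_W K (lt_le_trans y0 yz) => h; exact: is_deriveB.
- have z0 := lt_le_trans y0 yz.
  have /andP[fz _] := skew_normal_pdf_mills z0.
  have K0 : 0 <= K.
    by rewrite addr_ge0// divr_ge0// ?sqr_ge0// ltW.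
  have w5 : 0 <= E z * (4 * K * z^-1 ^+ 5).
    by rewrite !mulr_ge0// ?exprn_ge0// ?invr_ge0// ltW.
  have kk := ler_wpM2l (ltW k_gt0) fz.
  have -> : K * k - 2 = k / lambda ^+ 2.
    by rewrite /K; field; rewrite lt_eqF// gt_eqF.
  set w := z^-1 in kk w5 *; set e := E z in kk w5 *.
  set l2 := lambda^-2 in kk *.
  by rewrite opprK; nra.
- by rewrite -(subr0 0); apply: cvgB; [exact: cvgy_tail|exact: cvgy_W].
Qed.

End skew_normal_tail.

(** * Elementary estimates on exponentials and powers *)

Section exponential_estimates.
Variable R : realType.
Implicit Types u v x t p : R.

Lemma sqr_expRN_le t : 0 <= t -> t ^+ 2 * expR (- t) <= 2.
Proof.
move=> t0; rewrite expRN ler_pdivrMr ?expR_gt0//.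
have := @expR_ge1Dxn R t 1 t0; rewrite -[2`!%:R]/(2%:R); lra.
Qed.

(** A Lipschitz bound that keeps the factor [e^(-m)]: it later offsets the growth of [|u - v|] for
    negative [x]. *)
Lemma expR_opp_dist m u v : m <= u -> m <= v ->
  `|expR (- u) - expR (- v)| <= `|u - v| * expR (- m).
Proof.
wlog uv : u v / u <= v => [hw|].
  by case: (leP u v) => [/hw//|/ltW vu] mu mv; rewrite distrC (distrC u) hw.
move=> mu _.
have -> : expR (- v) = expR (- u) * expR (- (v - u)).
  by rewrite -expRD; congr expR; ring.
have e1 := expR_ge1Dx (- (v - u)).
have e2 : expR (- (v - u)) <= 1 by rewrite expR_le1; lra.
have -> : expR (- u) - expR (- u) * expR (- (v - u)) =
  expR (- u) * (1 - expR (- (v - u))) by ring.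
rewrite ger0_norm ?mulr_ge0 ?expR_ge0 ?subr_ge0// distrC ger0_norm ?subr_ge0//.
rewrite mulrC ler_pM ?expR_ge0 ?subr_ge0//; first lra.
by rewrite ler_expR lerN2.
Qed.

Lemma exprB_le (a b : R) n : 0 <= b <= a ->
  a ^+ n.+1 - b ^+ n.+1 <= n.+1%:R * (a - b) * a ^+ n.
Proof.
move=> /andP[b0 ba]; have a0 := le_trans b0 ba.
elim: n => [|n IH]; first by rewrite !expr1 expr0 mul1r mulr1.
have -> : a ^+ n.+2 - b ^+ n.+2 =
  a * (a ^+ n.+1 - b ^+ n.+1) + (a - b) * b ^+ n.+1.
  by rewrite !(exprS _ n.+1); ring.
have -> : n.+2%:R * (a - b) * a ^+ n.+1 =
  a * (n.+1%:R * (a - b) * a ^+ n) + (a - b) * a ^+ n.+1.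
  by rewrite -[n.+2%:R]natr1 !exprS; ring.
by rewrite lerD ?ler_wpM2l ?subr_ge0// lerXn2r.
Qed.

(** With [e^(-n p) = (e^(-p))^n] and [0 <= e^(-p) - (1 - p) <= p^2], [exprB_le] bounds the gap by
    [n p^2 e^(-(n-1) p)], and [t^2 e^(-t) <= 2] at [t = (n-1) p] makes this [O(1/n)]. *)
Lemma expR_exprB_gap (n : nat) p : (1 < n)%N -> 0 <= p <= 1 ->
  0 <= expR (- (n%:R * p)) - (1 - p) ^+ n <= 8 / n%:R.
Proof.
case: n => [|[|n]]// _ /andP[p0 p1].
have ep : 1 - p <= expR (- p) by have := expR_ge1Dx (- p).
(* From [e^p >= 1 + p] and [(1 - p + p^2) (1 + p) = 1 + p^3 >= 1]. *)
have ep2 : expR (- p) - (1 - p) <= p ^+ 2.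
  rewrite expRN lerBlDr -[leLHS]mul1r ler_pdivrMr ?expR_gt0//.
  have := expR_ge1Dx p; have : 0 < 1 - p + p ^+ 2 by nra.
  have : 1 <= (p ^+ 2 + (1 - p)) * (1 + p) by nra.
  nra.
have -> : expR (- (n.+2%:R * p)) = expR (- p) ^+ n.+2.
  by rewrite -expRM_natl; congr expR; ring.
rewrite subr_ge0 lerXn2r ?nnegrE ?expR_ge0 ?subr_ge0//=.
have bp : 0 <= 1 - p <= expR (- p) by rewrite ep subr_ge0 p1.
apply: (le_trans (exprB_le n.+1 bp)).
have q0 : 0 < n.+1%:R :> R by rewrite ltr0n.
have -> : expR (- p) ^+ n.+1 = expR (- (n.+1%:R * p)).
  by rewrite -expRM_natl; congr expR; ring.
have := sqr_expRN_le (mulr_ge0 (ltW q0) p0).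
have := expR_gt0 (- (n.+1%:R * p)); move: (expR (- (n.+1%:R * p))) => e e0 te.
rewrite ler_pdivlMr ?ltr0n//.
(* This costs a factor 4 after squaring, which with the 2 of [sqr_expRN_le] gives the 8. *)
have n2 : n.+2%:R <= 2 * n.+1%:R :> R.
  by rewrite -natrM ler_nat; lia.
have n20 : 0 <= n.+2%:R :> R by [].
have : n.+2%:R * (expR (- p) - (1 - p)) * e * n.+2%:R <=
  n.+2%:R * p ^+ 2 * e * n.+2%:R.
  by rewrite ler_wpM2r// ler_wpM2r ?(ltW e0)// ler_wpM2l.
move=> /le_trans; apply.
have : n.+2%:R * n.+2%:R <= 4 * n.+1%:R ^+ 2 :> R.
  by rewrite expr2 (_ : 4 * _ = (2 * n.+1%:R) * (2 * n.+1%:R)) ?ler_pM//; ring.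
move: (n.+1%:R) (n.+2%:R) q0 te => N M _ te MN.
have pe : 0 <= p ^+ 2 * e by rewrite mulr_ge0 ?sqr_ge0// ltW.
have := ler_wpM2r pe MN; lra.
Qed.

End exponential_estimates.

(** * The ratio of [n (1 - F y)] to [e^(-x)] *)

(* For [y = b (1 + s)] and [B = b^2], the tail bounds enclose
   [h = n (1 - F y) / e^(-x)] as in [h_ge] and [h_le]. *)
Section ratio_estimates.
Variables (R : realType) (k K B x s h : R).
Hypotheses (k1 : 1 <= k) (K0 : 0 <= K) (B0 : 0 < B) (KB : 8 * K <= B).
Hypotheses (xE : x = s * (k * B)) (s2 : - 1 <= 2 * s).
(** Since [k B (1 + s)^2 / 2 = k B / 2 + x + x^2 / (2 k B)], [q] is what the Gaussian factor leaves
    once [e^(-x)] is removed; [r] is [b / y]. *)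
Let q := expR (- (x ^+ 2 / (2 * k * B))).
Let r := (1 + s)^-1.
Hypothesis h_ge : q * r ^+ 2 * (1 - K * r ^+ 2 / B) <= h.
Hypothesis h_le : h <= q * r ^+ 2 * (1 - r ^+ 2 / (k * B)).

Let k0 : 0 < k. Proof. exact: lt_le_trans k1. Qed.
Let q0 : 0 < q. Proof. exact: expR_gt0. Qed.
Let a := x ^+ 2 / (2 * k * B).
Let a0 : 0 <= a.
Proof. by rewrite divr_ge0 ?sqr_ge0// !mulr_ge0// ltW. Qed.
Let q1 : q <= 1. Proof. by rewrite expR_le1 oppr_le0. Qed.
Let q_ge : 1 - a <= q. Proof. exact: expR_ge1Dx. Qed.
Let s1 : 0 < 1 + s. Proof. by have := s2; lra. Qed.
Let rs : r * (1 + s) = 1. Proof. by rewrite mulVf// gt_eqF. Qed.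
Let r0 : 0 < r. Proof. by rewrite invr_gt0. Qed.
Let r2 : r <= 2.
Proof.
have : r * 2^-1 <= r * (1 + s) by rewrite ler_pM2l//; have := s2; lra.
by rewrite rs; lra.
Qed.
Let rr4 : r ^+ 2 <= 4.
Proof.
have -> : 4 = 2 ^+ 2 :> R by ring.
by rewrite ler_sqr ?nnegrE// ltW.
Qed.
Let g := K * r ^+ 2 / B.
Let g_ge0 : 0 <= g.
Proof. by rewrite divr_ge0 ?mulr_ge0 ?sqr_ge0// ltW. Qed.
Let g_le : g <= 4 * (K / B).
Proof.
rewrite /g mulrAC mulrC ler_wpM2r// divr_ge0// ltW//.
Qed.
(** The origin of the hypothesis [8 * K <= B]: with [r <= 2] it keeps [1 - g] at least 1/2. *)
Let g_le2 : g <= 1 / 2.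
Proof.
apply: (le_trans g_le); rewrite mulrA ler_pdivrMr//; have := KB; lra.
Qed.

(** Here [q >= 1/2], [r >= 1] and [1 - g >= 1/2]. Crude, but enough to retain the decay of [e^(-u)]
    for negative [x]. *)
Lemma gumbel_ratio_ge : x <= 0 -> x ^+ 2 <= B -> 1 / 4 <= h.
Proof.
move=> x0 xB; apply: le_trans h_ge.
have a2 : a <= 1 / 2.
  rewrite /a ler_pdivrMr ?mulr_gt0//.
  have := ler_wpM2r (ltW B0) k1; lra.
have s0 : s <= 0.
  by move: x0; rewrite xE pmulr_lle0// mulr_gt0.
have r1 : 1 <= r.
  rewrite -rs ler_piMr// ?(ltW r0)//; lra.
have rr1 : 1 <= r ^+ 2 by rewrite expr_ge1// ltW.
have qr : 1 / 2 <= q * r ^+ 2.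
  by have := q_ge; have := ler_wpM2l (ltW q0) rr1; lra.
rewrite -/g; have := g_le2; nra.
Qed.

(** Each of [|s|], [a] and [g] is of order [(1 + x^2) / B]. From below [h >= 1 - 2|s| - 4a - 4g],
    from above [h <= r^2 <= 1 + 8|s|]; the constants follow. *)
Lemma gumbel_ratio_dist : `|h - 1| <= (4 / k + 16 * K) * (1 + x ^+ 2) / B.
Proof.
have sE : `|s| <= (1 + x ^+ 2) / (2 * (k * B)).
  have -> : s = x / (k * B) by rewrite xE mulfK// gt_eqF// mulr_gt0.
  rewrite normrM normfV (gtr0_norm (mulr_gt0 k0 B0)).
  rewrite (invfM 2) mulrA ler_pM2r ?invr_gt0 ?mulr_gt0//.
  rewrite ler_pdivlMr// -real_normK ?num_real//.
  by have := sqr_ge0 (`|x| - 1); rewrite sqrrB; lra.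
set t := (1 + x ^+ 2) / B.
have t0 : 0 <= t by rewrite divr_ge0 ?addr_ge0 ?sqr_ge0// ltW.
have -> : (4 / k + 16 * K) * (1 + x ^+ 2) / B = 4 * (t / k) + 16 * (K * t).
  by rewrite /t; field; rewrite !gt_eqF.
have {}sE : `|s| <= (t / k) / 2.
  apply: (le_trans sE); rewrite le_eqVlt; apply/orP; left; apply/eqP.
  by rewrite /t; field; rewrite !gt_eqF.
have at_ : a <= (t / k) / 2.
  have -> : t / k / 2 = (1 + x ^+ 2) / (2 * k * B).
    by rewrite /t; field; rewrite !gt_eqF.
  by rewrite /a ler_pM2r ?invr_gt0 ?mulr_gt0//; lra.
have gt_ : g <= 4 * (K * t).
  rewrite (le_trans g_le)// ler_wpM2l// ler_wpM2l//.
  by rewrite -[leLHS]mul1r ler_pM2r ?invr_gt0// lerDl sqr_ge0.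
have tk0 : 0 <= t / k by rewrite divr_ge0// ltW.
have Kt0 : 0 <= K * t by rewrite mulr_ge0.
move: (t / k) (K * t) sE at_ gt_ tk0 Kt0 => d1 d2 sE at_ gt_ d10 d20.
have rr0 : 0 <= r ^+ 2 by rewrite sqr_ge0.
have qr_le : q * r ^+ 2 <= r ^+ 2 by rewrite ler_piMl.
have qr0 : 0 <= q * r ^+ 2 by rewrite mulr_ge0// ltW.
have rr_le : r ^+ 2 <= 1 + 8 * `|s|.
  have -> : r ^+ 2 = 1 - s * (2 + s) * r ^+ 2.
    have -> : 1 - s * (2 + s) * r ^+ 2 = 1 + r ^+ 2 - (r * (1 + s)) ^+ 2.
      by ring.
    by rewrite rs; ring.
  have [s0|s0] := leP 0 s.
    have s20 : 0 <= 2 + s by lra.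
    have := mulr_ge0 (mulr_ge0 s0 s20) rr0; have := normr_ge0 s.
    lra.
  have : (- s) * (2 + s) * r ^+ 2 <= (- s) * 2 * 4.
    have ns : 0 <= - s by lra.
    apply: ler_pM => //; first by rewrite mulr_ge0//; have := s1; lra.
    by rewrite ler_wpM2l//; lra.
  by rewrite (ltr0_norm s0); lra.
(* [(1 - 2s)(1 + s)^2 = 1 - s^2 (3 + 2s)] is at most 1 as [2s >= -1]. *)
have rr_ge : 1 - 2 * `|s| <= r ^+ 2.
  have : 1 - 2 * s <= r ^+ 2.
    rewrite /r exprVn -[leRHS]mul1r ler_pdivlMr ?exprn_gt0//.
    have : 0 <= s ^+ 2 * (3 + 2 * s).
      by rewrite mulr_ge0 ?sqr_ge0//; have := s2; lra.
    by rewrite !expr2; nra.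
  by have := ler_norm s; lra.
rewrite ler_norml; apply/andP; split.
  have : q * r ^+ 2 * (1 - g) <= h by exact: h_ge.
  have : (1 - a) * r ^+ 2 <= q * r ^+ 2 by rewrite ler_wpM2r.
  have : a * r ^+ 2 <= a * 4 by rewrite ler_wpM2l.
  have : q * r ^+ 2 * g <= 4 * g by rewrite ler_wpM2r// (le_trans qr_le).
  lra.
have : q * r ^+ 2 * (1 - r ^+ 2 / (k * B)) <= q * r ^+ 2.
  by rewrite ler_piMr// gerBl divr_ge0// mulr_ge0// ltW.
by have := h_le; lra.
Qed.

End ratio_estimates.

(** * Distance to the Gumbel law for a fixed [n] *)

Section gumbel_rate.
Variables (R : realType) (lambda : R).
Hypothesis lambda_lt0 : lambda < 0.
Local Notation k := (1 + lambda ^+ 2).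
Local Notation K := (2 / k + 1 / lambda ^+ 2).
Local Notation F := (@skew_normal_cdf R lambda).
Variables (n : nat) (b : R).
Hypothesis b0 : 0 < b.
Hypothesis b16 : 16 <= b ^+ 2.
Hypothesis bK : 8 * K <= b ^+ 2.
Hypothesis nE :
  n%:R = pi * - lambda * k * b ^+ 2 * expR (k * b ^+ 2 / 2) :> R.
Hypothesis n2 : (1 < n)%N.
Implicit Types x : R.

Let k1 : 1 <= k. Proof. by rewrite lerDl sqr_ge0. Qed.
Let k0 : 0 < k. Proof. exact: lt_le_trans k1. Qed.
Let K0 : 0 <= K.
Proof. by rewrite addr_ge0// divr_ge0// ?sqr_ge0// ltW. Qed.
Let B0 : 0 < b ^+ 2. Proof. by rewrite exprn_gt0. Qed.
Let b4 : 4 <= b.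
Proof.
rewrite -ler_sqr ?nnegrE ?(ltW b0)//.
by have -> : 4 ^+ 2 = 16 :> R by ring.
Qed.
Let C := pi * - lambda * k.
Let C0 : 0 < C.
Proof. by rewrite !mulr_gt0 ?pi_gt0 ?oppr_gt0. Qed.

(** With [a_n = 1 / (k b)] the argument of [F] is [a_n x + b], and the ratio is [u / v] for
    [u = n (1 - F)] and [v = e^(-x)]. *)
Let ratio x := n%:R * (1 - F (b * (1 + x / (k * b ^+ 2)))) * expR x.

Let ratio_bounds x (s := x / (k * b ^+ 2)) (r := (1 + s)^-1)
    (q := expR (- (x ^+ 2 / (2 * k * b ^+ 2)))) : -1 <= 2 * s ->
  q * r ^+ 2 * (1 - K * r ^+ 2 / b ^+ 2) <= ratio x
  <= q * r ^+ 2 * (1 - r ^+ 2 / (k * b ^+ 2)).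
Proof.
move=> s2; have s1 : 0 < 1 + s by lra.
set y := b * (1 + s); have y0 : 0 < y by rewrite mulr_gt0.
(* [s >= -1/2] and [b >= 4] give [y >= 2], enough for the upper tail bound. *)
have ky : 4 <= k * y ^+ 2.
  have y2 : 2 <= y.
    have : b * 2^-1 <= y by rewrite ler_pM2l//; lra.
    by have := b4; lra.
  have y4 : 4 <= y ^+ 2.
    by have -> : 4 = 2 ^+ 2 :> R by [ring]; rewrite ler_sqr ?nnegrE// ltW.
  by rewrite (le_trans y4)// ler_peMl ?sqr_ge0.
have Eq : b ^+ 2 * expR (k * b ^+ 2 / 2) * expR x * expR (- (k * y ^+ 2 / 2))
    = b ^+ 2 * q.
  rewrite /q -mulrA -expRD -mulrA -expRD; congr (_ * expR _).
  by rewrite /y /s; field; rewrite !gt_eqF.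
have hE : ratio x =
    b ^+ 2 * expR (k * b ^+ 2 / 2) * expR x * (C * (1 - F y)).
  by rewrite /ratio nE -/s -/y /C; ring.
have e0 : 0 <= b ^+ 2 * expR (k * b ^+ 2 / 2) * expR x.
  by rewrite !mulr_ge0 ?expR_ge0// ltW.
have conv c : b ^+ 2 * expR (k * b ^+ 2 / 2) * expR x *
    (expR (- (k * y ^+ 2 / 2)) * (y^-1 ^+ 2 - c * y^-1 ^+ 4)) =
    q * r ^+ 2 * (1 - c * r ^+ 2 / b ^+ 2).
  rewrite mulrA Eq /y /r; field.
  by rewrite !gt_eqF.
rewrite hE; apply/andP; split.
  by rewrite -conv ler_wpM2l// skew_normal_tail_ge.
have -> : r ^+ 2 / (k * b ^+ 2) = k^-1 * r ^+ 2 / b ^+ 2.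
  by rewrite invfM; ring.
by rewrite -conv ler_wpM2l// skew_normal_tail_le.
Qed.

Let H := 4 / k + 16 * K.
Let H0 : 0 <= H.
Proof. by rewrite addr_ge0 ?mulr_ge0// invr_ge0 ltW. Qed.

Let F_itv y : 0 <= 1 - F y <= 1.
Proof. by rewrite subr_ge0 skew_normal_cdf_le1 gerBl skew_normal_cdf_ge0. Qed.

Let n0 : 0 < n%:R :> R. Proof. by rewrite ltr0n; lia. Qed.

(** Two errors add up: [F^n] against [e^(-u)] costs [8 / n <= 8 / (C b^2)], and [e^(-u)] against
    [e^(-v)] is controlled through [u / v]. *)
Lemma skew_normal_gumbel_dist_right x : - b <= x ->
  `|F (b * (1 + x / (k * b ^+ 2))) ^+ n - gumbel_cdf x|
  <= (64 * H + 8 / C) / b ^+ 2.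
Proof.
move=> bx; set s := x / (k * b ^+ 2); set y := b * (1 + s).
have kB0 : 0 < k * b ^+ 2 by rewrite mulr_gt0.
have s2 : -1 <= 2 * s.
  rewrite /s mulrA ler_pdivlMr//.
  have : b ^+ 2 <= k * b ^+ 2 by rewrite ler_peMl// ltW.
  have : 4 * b <= b ^+ 2 by rewrite expr2 ler_pM2r.
  by move: bx b0; lra.
have /andP[h_ge h_le] := ratio_bounds s2.
have xE : x = s * (k * b ^+ 2) by rewrite mulfVK ?gt_eqF.
have hd := gumbel_ratio_dist k1 K0 B0 xE s2 h_ge h_le.
set v := expR (- x); set u := n%:R * (1 - F y).
have v0 : 0 < v by exact: expR_gt0.
have uE : u = v * ratio x.
  by rewrite /ratio -/s -/y -/u mulrCA /v expRN mulVf ?mulr1// expR_eq0.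
have /andP[g1 g2] := expR_exprB_gap n2 (F_itv y).
rewrite -/u subKr in g1 g2.
have n8 : 8 / n%:R <= 8 / C / b ^+ 2.
  have CB0 : 0 < C * b ^+ 2 by exact: mulr_gt0.
  rewrite nE -/C -(mulrA 8) -invfM ler_wpM2l//.
  rewrite lef_pV2 ?posrE ?(pmulr_rgt0 _ CB0) ?expR_gt0//.
  rewrite ler_peMr ?(ltW CB0)//.
  by apply: le_trans (expR_ge1Dx _); rewrite lerDl divr_ge0// ltW.
suff duv : `|expR (- u) - expR (- v)| <= 64 * H / b ^+ 2.
  rewrite /gumbel_cdf -/v.
  have -> : F y ^+ n - expR (- v) =
    (expR (- u) - expR (- v)) - (expR (- u) - F y ^+ n) by ring.
  rewrite (le_trans (ler_normB _ _))// (ger0_norm g1) [leRHS]mulrDl.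
  by rewrite lerD// (le_trans g2).
have uv : `|u - v| <= v * (H * (1 + x ^+ 2) / b ^+ 2).
  have -> : u - v = v * (ratio x - 1) by rewrite uE; ring.
  by rewrite normrM (gtr0_norm v0) ler_pM2l.
have HB : 0 <= H / b ^+ 2 by rewrite divr_ge0// ltW.
(* For [x >= 0] the decay of [v] beats [1 + x^2]; for [x < 0] the factor [e^(-v/4)] does. *)
have [x0|x0] := leP 0 x.
  have u0 : 0 <= u by rewrite mulr_ge0//; have /andP[] := F_itv y.
  apply: (le_trans (expR_opp_dist u0 (ltW v0))).
  rewrite oppr0 expR0 mulr1 (le_trans uv)//.
  have vx : v * (1 + x ^+ 2) <= 2.
    rewrite /v expRN mulrC ler_pdivrMr ?expR_gt0//.
    have := @expR_ge1Dxn R x 1 x0; rewrite -[2`!%:R]/(2%:R); lra.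
  have := ler_wpM2r HB vx; lra.
have xB : x ^+ 2 <= b ^+ 2.
  by rewrite -(sqrrN x) ler_sqr ?nnegrE; [lra|lra|exact: ltW].
have h4 := gumbel_ratio_ge k1 K0 B0 bK xE s2 h_ge (ltW x0) xB.
have u4 : v / 4 <= u.
  by have := ler_wpM2l (ltW v0) h4; rewrite -uE; lra.
have v4 : v / 4 <= v by lra.
apply: (le_trans (expR_opp_dist u4 v4)).
apply: (le_trans (ler_wpM2r (expR_ge0 _) uv)).
have nx0 : 0 <= - x by lra.
have vx : 1 + x ^+ 2 <= 2 * v.
  have := @expR_ge1Dxn R (- x) 1 nx0; rewrite -[2`!%:R]/(2%:R) sqrrN -/v; lra.
have v40 : 0 <= v / 4 by lra.
have := sqr_expRN_le v40.
move: (expR (- (v / 4))) (expR_ge0 (- (v / 4))) => e e0 ve.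
(* Since [1 + x^2 <= 2 v], the product is at most [2 v^2 e^(-v/4) = 32 (v/4)^2 e^(-v/4) <= 64]. *)
have vxe : v * (1 + x ^+ 2) * e <= v * (2 * v) * e.
  by rewrite ler_wpM2r// ler_pM2l.
have : v * (1 + x ^+ 2) * e <= 64 by move: ve; rewrite expr2; lra.
move=> /(ler_wpM2r HB); lra.
Qed.

(** For [x < - b] both functions lie between 0 and their values at [- b]. There
    [exp (- e^b) <= 2 / b^2] because [exp (e^b) >= e^b >= b^2 / 2], and [F^n] exceeds it by at most
    the previous bound. *)
Lemma skew_normal_gumbel_dist x :
  `|F (b * (1 + x / (k * b ^+ 2))) ^+ n - gumbel_cdf x|
  <= (64 * H + 8 / C + 4) / b ^+ 2.
Proof.
have [bx|xb] := leP (- b) x.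
  rewrite (le_trans (skew_normal_gumbel_dist_right bx))//.
  by rewrite ler_pM2r ?invr_gt0//; lra.
have := skew_normal_gumbel_dist_right (lexx (- b)).
set d := (_ / _ in X in _ <= X -> _) => hb.
have -> : (64 * H + 8 / C + 4) / b ^+ 2 = d + 4 / b ^+ 2 by rewrite /d; ring.
have gb : gumbel_cdf (- b) <= 2 / b ^+ 2.
  rewrite /gumbel_cdf opprK expRN -(invf_div (b ^+ 2)).
  rewrite lef_pV2 ?posrE ?expR_gt0 ?divr_gt0//.
  have := @expR_ge1Dxn R b 1 (ltW b0); rewrite -[2`!%:R]/(2%:R).
  by have := expR_ge1Dx (expR b); lra.
have gx : 0 <= gumbel_cdf x <= gumbel_cdf (- b).
  by rewrite expR_ge0 ler_expR lerN2 ler_expR; lra.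
have Fx : 0 <= F (b * (1 + x / (k * b ^+ 2))) ^+ n
    <= F (b * (1 + - b / (k * b ^+ 2))) ^+ n.
  rewrite exprn_ge0 ?skew_normal_cdf_ge0//=.
  rewrite lerXn2r ?nnegrE ?skew_normal_cdf_ge0//.
  apply: skew_normal_cdf_homo; rewrite ler_pM2l// lerD2l ler_pM2r ?ltW//.
  by rewrite invr_gt0 mulr_gt0.
move: gx Fx hb; rewrite !ler_norml => /andP[? ?] /andP[? ?] /andP[? ?].
have : 4 / b ^+ 2 = 2 * (2 / b ^+ 2) by ring.
by move=> ?; apply/andP; split; lra.
Qed.

(** At [x = 0], [q = r = 1], so [u <= 1 - t] with [t = 1 / (k b^2)] and [e^(-u) >= e^(-1) (1 + t)];
    passing from [e^(-u)] to [F^n] loses at most half of the gain. *)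
Lemma skew_normal_gumbel_dist0 : 32 * expR 1 / C <= b ^+ 2 ->
  expR (- 1) / (2 * k) / b ^+ 2 <= `|F b ^+ n - gumbel_cdf 0|.
Proof.
move=> bC; apply: le_trans (ler_norm _).
have kB0 : 0 < k * b ^+ 2 by exact: mulr_gt0.
set t := (k * b ^+ 2)^-1; have t0 : 0 < t by rewrite invr_gt0.
set u := n%:R * (1 - F b).
have u_le : u <= 1 - t.
  have s2 : -1 <= 2 * (0 / (k * b ^+ 2)) by rewrite mul0r mulr0 lerN10.
  have /andP[_] := ratio_bounds s2.
  rewrite /ratio mul0r addr0 mulr1 expR0 mulr1 -/u expr0n/= mul0r oppr0 expR0.
  by rewrite invr1 expr1n !mul1r.
have /andP[_] := expR_exprB_gap n2 (F_itv b); rewrite -/u subKr => gap.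
have -> : gumbel_cdf 0 = expR (- 1) :> R by rewrite /gumbel_cdf oppr0 expR0.
have tE : expR (- 1) / (2 * k) / b ^+ 2 = expR (- 1) * t / 2.
  by rewrite /t; field; rewrite !gt_eqF.
have eu : expR (- 1) * (1 + t) <= expR (- u).
  apply: (@le_trans _ _ (expR (- 1) * expR t)).
    by rewrite ler_pM2l ?expR_gt0// expR_ge1Dx.
  by rewrite -expRD ler_expR lerNr opprD opprK.
(* [n >= C b^2 * k b^2 / 2] makes [8 / n] of order [b^(-4)], and [32 e / C <= b^2] brings it below
   that half. *)
have n8 : 8 / n%:R <= expR (- 1) * t / 2.
  rewrite ler_pdivrMr//.
  have nC : C * b ^+ 2 * (k * b ^+ 2 / 2) <= n%:R.
    rewrite nE -/C ler_wpM2l//; first by rewrite mulr_ge0 ?ltW.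
    by apply: le_trans (expR_ge1Dx _); rewrite lerDr.
  have et0 : 0 <= expR (- 1) * t / 2.
    by rewrite divr_ge0// mulr_ge0 ?expR_ge0// ltW.
  apply: le_trans (ler_wpM2l et0 nC).
  have -> : expR (- 1) * t / 2 * (C * b ^+ 2 * (k * b ^+ 2 / 2)) =
      expR (- 1) * (b ^+ 2 * C) / 4.
    by rewrite /t; field; rewrite !gt_eqF.
  rewrite ler_pdivrMr// in bC.
  have := ler_wpM2l (expR_ge0 (- 1)) bC.
  have : expR (- 1) * expR 1 = 1 :> R by rewrite mulrC expRxMexpNx_1.
  by lra.
rewrite tE; move: (expR (- u)) (F b ^+ n) (8 / n%:R) gap eu n8 => p1 p2 p3.
by move: (expR (- 1)) => p4; lra.
Qed.

End gumbel_rate.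

(** * From [b_n^2] to [log n], and the theorem *)

Lemma ln_bounds_of_scale (R : realType) (k C B N : R) : 0 < k -> 0 < B ->
  1 <= C * B -> N = C * B * expR (k * B / 2) ->
  k * B / 2 <= ln N <= (C + k / 2) * B.
Proof.
move=> k0 B0 CB1 ->; have CB0 : 0 < C * B by apply: lt_le_trans CB1.
(* [ln N = ln (C B) + k B / 2], with [0 <= ln (C B) <= C B]. *)
rewrite lnM ?posrE ?expR_gt0// expRK lerDr ln_ge0//=.
by have := ltW (ln_sublinear CB0); lra.
Qed.

Theorem theorem2p3 (R : realType) (lambda : R) (lambda_lt0 : lambda < 0) :
  exists (n0 : nat) (C1 C2 : R),
    [/\ (0 < n0)%N, 0 < C1, 0 < C2 &
      forall a b : nat -> R,
        (forall n : nat, (0 < n)%N ->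
          0 < b n /\
          pi * `|lambda| * (1 + lambda ^+ 2) * b n ^+ 2
            * expR ((1 + lambda ^+ 2) * b n ^+ 2 / 2) = n%:R) ->
        (forall n : nat, (0 < n)%N ->
          a n = (1 + lambda ^+ 2)^-1 * (b n)^-1) ->
        forall n : nat, (n0 <= n)%N ->
          C1 / ln n%:R
            < sup [set `|skew_normal_cdf lambda (a n * x + b n) ^+ n
                         - gumbel_cdf x| | x in [set: R]]
            < C2 / ln n%:R].
Proof.
set k := 1 + lambda ^+ 2; set K := 2 / k + 1 / lambda ^+ 2.
set C := pi * - lambda * k; set L := expR (- 1) / (2 * k).
set M := 64 * (4 / k + 16 * K) + 8 / C + 4.
(* [B] collects the three lower bounds required of [b_n^2]; [N] is the [n] whose [b_n^2] would be
   [B]. *)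
set B := 16 + 8 * K + 32 * expR 1 / C; set N := C * B * expR (k * B / 2).
have k0 : 0 < k by rewrite ltr_wpDr ?sqr_ge0.
have C0 : 0 < C by rewrite !mulr_gt0 ?pi_gt0 ?oppr_gt0.
have K0 : 0 <= K by rewrite addr_ge0// divr_ge0// ?sqr_ge0// ltW.
have L0 : 0 < L by rewrite divr_gt0 ?expR_gt0 ?mulr_gt0.
have eC0 : 0 < 32 * expR 1 / C by rewrite divr_gt0// mulr_gt0// expR_gt0.
have kV0 : 0 < k^-1 by rewrite invr_gt0.
have CV0 : 0 < C^-1 by rewrite invr_gt0.
have M0 : 0 < M by rewrite /M; lra.
have B0 : 0 < B by rewrite /B; lra.
(* The first witness exceeds [N] and is at least 2. [L * k / 4] is half of what
   [b_n^2 <= 2 ln n / k] gives, for strictness; so is the final [+ 1]. *)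
exists (Num.truncn N).+2, (L * k / 4), (M * (C + k / 2) + 1); split => //.
- by rewrite divr_gt0// mulr_gt0.
- by rewrite ltr_wpDl// mulr_ge0 ?(ltW M0)// addr_ge0 ?(ltW C0)// divr_ge0// ltW.
move=> a b bE aE n nN; have n_gt0 : (0 < n)%N by apply: leq_trans nN.
have n_gt1 : (1 < n)%N by apply: leq_trans nN.
have [b0] := bE n n_gt0; rewrite -/k (ltr0_norm lambda_lt0) -/C => /esym nE.
(* The right side of the equation increases with [b_n^2]: a value below [B] would give [n <= N]. *)
have Bb : B <= b n ^+ 2.
  have Nn : N < n%:R.
    by rewrite (lt_le_trans (truncnS_gt N))// ler_nat ltnW.
  rewrite leNgt; apply/negP => bB; move: Nn; rewrite ltNge => /negP; apply.
  rewrite nE /N; apply: ler_pM; rewrite ?expR_ge0//.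
  - by apply: mulr_ge0; [exact: ltW|exact: sqr_ge0].
  - by rewrite ler_pM2l// ltW.
  - by rewrite ler_expR ler_pM2r// ler_pM2l// ltW.
have b2_gt0 : 0 < b n ^+ 2 by rewrite exprn_gt0.
have b16 : 16 <= b n ^+ 2 by move: Bb; rewrite /B; lra.
have bK : 8 * K <= b n ^+ 2 by move: Bb; rewrite /B; lra.
have bC : 32 * expR 1 / C <= b n ^+ 2 by move: Bb; rewrite /B; lra.
have CB1 : 1 <= C * b n ^+ 2.
  move: bC; rewrite ler_pdivrMr// (mulrC C); apply: le_trans.
  by have := expR_ge1Dx (1 : R); lra.
have /andP[ln_ge ln_le] := ln_bounds_of_scale k0 b2_gt0 CB1 nE.
have ln0 : 0 < ln n%:R :> R.
  by apply: lt_le_trans ln_ge; rewrite divr_gt0 ?mulr_gt0.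
have axb x : a n * x + b n = b n * (1 + x / (k * b n ^+ 2)).
  by rewrite aE// -/k; field; rewrite !gt_eqF.
set S := [set _ | _ in _].
have ubS : ubound S (M / b n ^+ 2).
  move=> _ [x _ <-]; rewrite axb.
  exact: (skew_normal_gumbel_dist lambda_lt0 b0 b16 bK nE n_gt1).
(* The point [x = 0] gives the lower bound on the supremum and shows that [S] is not empty for the
   upper one. *)
have S0 : S `|skew_normal_cdf lambda (b n) ^+ n - gumbel_cdf 0|.
  by exists 0 => //; rewrite mulr0 add0r.
apply/andP; split.
  apply: (@lt_le_trans _ _ (L / b n ^+ 2)).
    rewrite ltr_pdivrMr// [ltRHS]mulrAC ltr_pdivlMr//.
    apply: (@lt_le_trans _ _ (L * (k * b n ^+ 2 / 2))); last by rewrite ler_pM2l.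
    have := mulr_gt0 (mulr_gt0 L0 k0) b2_gt0; lra.
  have hL := skew_normal_gumbel_dist0 lambda_lt0 b0 b16 bK nE n_gt1 bC.
  by rewrite (le_trans hL)// (ub_le_sup _ S0)//; exists (M / b n ^+ 2).
apply: (@le_lt_trans _ _ (M / b n ^+ 2)).
  by apply: ge_sup => //; eexists; exact: S0.
rewrite ltr_pdivlMr// [ltLHS]mulrAC ltr_pdivrMr// [ltRHS]mulrDl mul1r.
apply: (@le_lt_trans _ _ (M * ((C + k / 2) * b n ^+ 2))).
  by rewrite ler_pM2l.
by rewrite mulrA ltrDl.
Qed.
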